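(* Let $\mathcal{G}=(\mathcal{V},\mathcal{E},A)$ be a weighted digraph on $n$ nodes that contains a directed spanning tree, with graph Laplacian $L$. Let $\bar f:\mathbb{R}\to\mathbb{R}$ be an increasing (not necessarily continuous, not necessarily strictly increasing) function with $\lim_{y\to\infty}|\bar f(y)|=\infty$. Then every solution $x:[0,\infty)\to\mathbb{R}^n$ of the differential inclusion $$\dot x(t)\in -L\left(\mathcal{F}[\bar f](x_1(t))\times\cdots\times\mathcal{F}[\bar f](x_n(t))\right)$$ converges asymptotically (as $t\to\infty$, in the sense that its distance to the set tends to $0$) to the set $$\mathcal{D}_2=\{x\in\mathbb{R}^n \mid \exists a\in\mathbb{R}\ \text{such that}\ a\mathbf{1}_n\in \mathcal{F}[\bar f](x_1)\times\cdots\times\mathcal{F}[\bar f](x_n)\}.$$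
   Context: Weighted digraph: node set $\mathcal{V}=\{v_1,\dots,v_n\}$, edge set $\mathcal{E}\subseteq\mathcal{V}\times\mathcal{V}$, adjacency matrix $A=[a_{ij}]$ with $a_{ij}\ge 0$, $a_{ii}=0$, and $a_{ij}>0$ if and only if $(v_j,v_i)\in\mathcal{E}$. The graph Laplacian is $L=\Delta-A$, where $\Delta$ is diagonal with $\Delta_{ii}=\sum_{j}a_{ij}$. The digraph contains a directed spanning tree if there is a node (a root) from which there is a directed path to every other node. $\mathbf{1}_n$ is the all-ones vector in $\mathbb{R}^n$. For a map $X:\mathbb{R}^m\to\mathbb{R}^m$ the Filippov set-valued map is $\mathcal{F}[X](x)=\bigcap_{\delta>0}\bigcap_{\mu(S)=0}\overline{\mathrm{co}}\{X(B(x,\delta)\setminus S)\}$, where $B(x,\delta)$ is the open ball, $\mu$ is Lebesgue measure and $\overline{\mathrm{co}}$ is the closed convex hull. A solution of a differential inclusion is a (locally) absolutely continuous function satisfying the inclusion for almost every $t$. *)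

(* Defs.v *)
From HB Require Import structures.
From mathcomp Require Import all_boot all_order all_algebra.
From mathcomp Require Import all_classical all_reals all_analysis.

Set Implicit Arguments.
Unset Strict Implicit.
Unset Printing Implicit Defensive.

Import Order.TTheory GRing.Theory Num.Theory.
Import numFieldNormedType.Exports.

Local Open Scope classical_set_scope.
Local Open Scope ring_scope.

(* [edge j i] is the edge (v_j, v_i); it carries the weight a_ij, so the
   indices of the adjacency matrix are reversed with respect to the edge. *)
Record weightedDigraph (R : numDomainType) (n : nat) := WeightedDigraph {
  edge : rel 'I_n ;
  adjacency : 'M[R]_n ;
  adjacency_ge0 : forall i j, 0 <= adjacency i j ;
  adjacency_diag : forall i, adjacency i i = 0 ;
  adjacency_gt0 : forall i j, (0 < adjacency i j) = edge j i }.

Definition laplacian (R : numDomainType) (n : nat) (G : weightedDigraph R n) :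
    'M[R]_n :=
  diag_mx (\row_i \sum_j adjacency G i j) - adjacency G.

Definition has_directed_spanning_tree (R : numDomainType) (n : nat)
    (G : weightedDigraph R n) : Prop :=
  exists r : 'I_n, forall v : 'I_n, connect (edge G) r v.

Definition closed_convex_hull (R : realType) (V : normedModType R) (A : set V) :
    set V :=
  smallest [set C : set V | closed C /\ convex_set C] A.

(* S ranges over all Lebesgue-null sets, Borel or not. [R^o] is [R] seen as a
   vector space over itself. *)
Definition filippov (R : realType) (f : R -> R) (x : R) : set R :=
  \bigcap_(delta in [set delta : R | 0 < delta])
  \bigcap_(S in [set S : set R | (@lebesgue_measure R).-negligible S])
    closed_convex_hull (f @` (ball x delta `\` S) : set R^o).

Definition filippov_prod (R : realType) (f : R -> R) (n : nat) (x : 'cV[R]_n) :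
    set 'cV[R]_n :=
  [set v | forall i, filippov f (x i ord0) (v i ord0)].

(* Degenerate intervals are allowed in the families: they contribute 0. *)
Definition absolutely_continuous (R : realType) (V : normedModType R)
    (a b : R) (u : R -> V) : Prop :=
  forall e : R, 0 < e -> exists2 d : R, 0 < d &
    forall (m : nat) (s t : 'I_m -> R),
      (forall i, a <= s i /\ s i <= t i /\ t i <= b) ->
      trivIset setT (fun i => `]s i, t i[%classic) ->
      \sum_(i < m) (t i - s i) < d ->
      \sum_(i < m) `|u (t i) - u (s i)| < e.

(* A solution on [0, +oo[ is a total function whose values at negative times
   are irrelevant: the only point of [0, +oo[ where they could affect the
   derivative is 0, which is negligible. *)
Definition inclusion_solution (R : realType) (V : normedModType R)
    (Phi : V -> set V) (x : R -> V) : Prop :=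
  (forall a b : R, 0 <= a -> a <= b -> absolutely_continuous a b x) /\
  {ae @lebesgue_measure R, forall t : R, 0 <= t ->
     derivable x t 1 /\ Phi (x t) (derive1 x t)}.

Definition consensus_rhs (R : realType) (n : nat) (G : weightedDigraph R n)
    (f : R -> R) (x : 'cV[R]_n) : set 'cV[R]_n :=
  [set - (laplacian G *m v) | v in filippov_prod f x].

Definition setD2 (R : realType) (n : nat) (f : R -> R) : set 'cV[R]_n :=
  [set x | exists a : R, filippov_prod f x (const_mx a)].

(* [edist_inf D] is the distance to D for the sup norm of 'cV[R]_n. *)
Definition converges_to_set (R : realType) (V : pseudoMetricType R)
    (x : R -> V) (D : set V) : Prop :=
  edist_inf D (x t) @[t --> +oo] --> 0%E.

(* Main.v *)
Require Import Defs.
From mathcomp Require Import all_boot all_order all_algebra.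
From mathcomp Require Import all_classical all_reals all_analysis.
From mathcomp Require Import ring lra.

Set Implicit Arguments.
Unset Strict Implicit.
Unset Printing Implicit Defensive.

Import Order.TTheory GRing.Theory Num.Theory.
Import numFieldNormedType.Exports.

Local Open Scope classical_set_scope.
Local Open Scope ring_scope.

(**
Along a solution, x' = - L w with w_i in F[f](x_i), and x and w are ordered the
same way, since F[f] is monotone. Hence the maximum of x over a set of nodes
closed under in-neighbours is nonincreasing, and the minimum is nondecreasing.
Let [m, M] be the interval spanned by the limits of the extremes over all nodes,
and mP <= MP the limits of the minimum and the maximum over the roots. If f is
constant on ]m, M[, then the box [m, M]^n lies in D2 and attracts x.

Constancy comes from the convex functional H_l(z) = sum_k q^k S_k(z), where
S_k(z) is the largest sum of z_i - l over at most k + 1 nodes. At a point x with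
selection w, a subgradient of S_k is the indicator of a top set of nodes; the
flow into such a set is at most C times the gaps of w inside it minus a times the
gap of w at its boundary, as soon as the set misses a root. For q = a / (C + a)
these bounds telescope, so H_l decreases at a rate proportional to max w - v,
where v bounds w on the nodes below the level l. With l = mP this forces f to be
constant on ]mP, M[, and by symmetry on ]m, MP[. If m < mP < M, it remains to
compare both sides of a possible jump at s = mP: at every time either some root
has w < c, and H_s decreases, or all roots have w >= c, and the mirror image of
H_s decreases.
*)

(** * The Filippov map of a monotone function *)

Section filippov_monotone.
Context (R : realType).
Implicit Types (f : R -> R) (y z w : R).

(** The intersection defining F[f] is used only at the radius [d] and the empty null set. *)
Lemma filippov_sub f y w d (C : set R^o) : 0 < d -> closed C -> convex_set C ->
  (forall z, ball y d z -> C (f z)) -> filippov f y w -> C w.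
Proof.
move=> d0 clC cvC fC /(_ _ d0 _ (negligible_set0 _)).
by apply; split => // _ [z [/fC ? _] <-].
Qed.

Lemma filippov_ge f y z w :
  {homo f : u v / u <= v} -> filippov f y w -> z < y -> f z <= w.
Proof.
move=> fm fw zy; have yz0 : 0 < y - z by rewrite subr_gt0.
apply: (@filippov_sub f y w (y - z) [set v | f z <= v]) => //.
- move=> a b k; rewrite !inE /= => za zb.
  change (f z <= k%:num * a + (1 - k%:num) * b).
  have k0 : 0 <= k%:num by []. have k1 : 0 <= (1 - k%:num) by rewrite subr_ge0.
  have := ler_wpM2l k0 za; have := ler_wpM2l k1 zb.
  rewrite !mulrBl; lra.
- move=> v; rewrite /ball /= => yv; apply: fm.
  by have := ler_norm (y - v); lra.
Qed.

Lemma filippov_le f y z w :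
  {homo f : u v / u <= v} -> filippov f y w -> y < z -> w <= f z.
Proof.
move=> fm fw yz; have yz0 : 0 < z - y by rewrite subr_gt0.
apply: (@filippov_sub f y w (z - y) [set v | v <= f z]) => //.
- move=> a b k; rewrite !inE /= => za zb.
  change (k%:num * a + (1 - k%:num) * b <= f z).
  have k0 : 0 <= k%:num by []. have k1 : 0 <= (1 - k%:num) by rewrite subr_ge0.
  have := ler_wpM2l k0 za; have := ler_wpM2l k1 zb.
  rewrite !mulrBl; lra.
- move=> v; rewrite /ball /= => yv; apply: fm.
  by have := ler_norm (v - y); rewrite distrC in yv; lra.
Qed.

(** A nonempty open interval has positive measure, so deleting a null set leaves sample points on
    either side of a given point. *)
Lemma itv_not_negligible (S : set R) (a b : R) :
  (@lebesgue_measure R).-negligible S -> a < b ->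
  exists2 z, a < z < b & ~ S z.
Proof.
move=> [A [mA A0 SA]] ab; apply: contrapT => H.
have abA : `]a, b[%classic `<=` A.
  move=> z; rewrite /= in_itv /= => zab; apply: SA.
  by apply: contrapT => nSz; apply: H; exists z.
have : (@lebesgue_measure R `]a, b[%classic <= lebesgue_measure A)%E.
  apply: le_measure => //; rewrite inE //; exact: measurable_itv.
rewrite [X in (_ <= X)%E]A0 lebesgue_measure_itv /= lte_fin ab -EFinB lee_fin; lra.
Qed.

(** This identifies F[f](y) with [f(y-), f(y+)] without naming one-sided limits. For the converse, a
    competing set [C] contains values of [f] at some z1 < y < z2, and [w] is a convex combination of
    the two. *)
Lemma filippovP f y w : {homo f : u v / u <= v} ->
  filippov f y w <->
  (forall z, z < y -> f z <= w) /\ (forall z, y < z -> w <= f z).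
Proof.
move=> fm; split=> [fw|[wge wle] d /= d0 S Snull C [[clC cvC] fC]].
  by split=> z; [apply: (filippov_ge fm fw) | apply: (filippov_le fm fw)].
have [|z1 /andP[z1l z1u] Sz1] := @itv_not_negligible S (y - d) y Snull.
  by rewrite ltrBlDr ltrDl.
have [|z2 /andP[z2l z2u] Sz2] := @itv_not_negligible S y (y + d) Snull.
  by rewrite ltrDl.
have Cz1 : C (f z1).
  by apply: fC; exists z1 => //; split=> //; rewrite /ball /= gtr0_norm; lra.
have Cz2 : C (f z2).
  by apply: fC; exists z2 => //; split=> //; rewrite /ball /= ltr0_norm; lra.
have w1 := wge _ z1u; have w2 := wle _ z2l.
have [e|ne] := eqVneq (f z1) (f z2).
  by have -> : w = f z1 by apply/eqP; rewrite eq_le w1 e w2.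
have f12 : 0 < f z2 - f z1 by rewrite subr_gt0 lt_neqAle ne (le_trans w1 w2).
(* The barycentric coordinate of [w], from solving k f(z1) + (1 - k) f(z2) = w. *)
pose k := (f z2 - w) / (f z2 - f z1).
have k0 : 0 <= k by apply: divr_ge0; [rewrite subr_ge0 | exact: ltW].
have k1 : k <= 1 by rewrite ler_pdivrMr // mul1r; lra.
pose p : {i01 R} := Itv01 k0 k1.
have cz : (f z1 : convex_lmodType R^o) \in C /\ (f z2 : convex_lmodType R^o) \in C.
  by rewrite !inE.
have := cvC _ _ p cz.1 cz.2; rewrite inE.
suff <- : k * f z1 + (1 - k) * f z2 = w by [].
by rewrite /k; field; rewrite gt_eqF.
Qed.

Lemma filippov_comonotone f y z w v : {homo f : u v / u <= v} ->
  filippov f y w -> filippov f z v -> y < z -> w <= v.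
Proof.
move=> fm fw fv yz; have m1 := midf_lt yz.
by apply: (@le_trans _ _ (f ((y + z) / 2)));
  [apply: (filippov_le fm fw) | apply: (filippov_ge fm fv)]; lra.
Qed.

(** The symmetry x -> -x, f -> -f(-.) preserves the setting and swaps maxima with minima; every
    statement about minima is obtained through it. *)
Lemma homo_reflect f : {homo f : u v / u <= v} ->
  {homo (fun u => - f (- u)) : u v / u <= v}.
Proof. by move=> fm u v uv; rewrite lerN2 fm // lerN2. Qed.

Lemma filippov_reflect f y w : {homo f : u v / u <= v} ->
  filippov f y w -> filippov (fun u => - f (- u)) (- y) (- w).
Proof.
move=> fm /(filippovP _ _ fm) [wge wle].
apply/filippovP; first exact: homo_reflect.
by split=> z zy; rewrite lerN2; [apply: wle | apply: wge]; lra.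
Qed.

End filippov_monotone.

(** * Absolutely continuous functions with nonpositive left derivative *)

Section absolutely_continuous_monotone.
Context (R : realType).
Implicit Types (g : R -> R) (U N : set R).

(** These are the families fed to absolute continuity; confining them to [U] bounds their total
    length by the measure of [U]. *)
Definition itv_family U (t b : R) m (s u : 'I_m -> R) :=
  [/\ forall i, t <= s i /\ s i <= u i /\ u i <= b,
      trivIset setT (fun i => `]s i, u i[%classic) &
      forall i, `]s i, u i[%classic `<=` U].

Lemma itv_family_weaken U t t' b m (s u : 'I_m -> R) :
  t' <= t -> itv_family U t b s u -> itv_family U t' b s u.
Proof.
move=> t't [sub tI sU]; split => // i.
by have [? ?] := sub i; split => //; apply: le_trans t't _.
Qed.

(** The new interval takes index 0 and the old ones are shifted by [lift]. Disjointness holds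
    because it ends at [t], where the old ones may begin. *)
Lemma itv_family_cons U t t' b m (s u : 'I_m -> R) :
  t' <= t -> t <= b -> `]t', t[%classic `<=` U -> itv_family U t b s u ->
  itv_family U t' b (fun i => oapp s t' (unlift ord0 i))
                    (fun i => oapp u t (unlift ord0 i)).
Proof.
move=> t't tb t'U [sub tI sU]; split.
- move=> i; case: unliftP => [j _|_] /=; last by [].
  by have [? ?] := sub j; split => //; apply: le_trans t't _.
- move=> i j _ _; case: unliftP => [i' ->|->]; case: unliftP => [j' ->|->] //= [z].
  + by move=> ne; congr lift; apply: tI => //; exists z.
  + by rewrite /= !in_itv /= => -[/andP[z1 z2] /andP[z3 z4]];
    have := lt_trans (le_lt_trans (sub i').1 z1) z4; rewrite ltxx.
  + by rewrite /= !in_itv /= => -[/andP[z1 z2] /andP[z3 z4]];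
    have := lt_trans (le_lt_trans (sub j').1 z3) z2; rewrite ltxx.
- by move=> i; case: unliftP => [j _|_] /=.
Qed.

Lemma itv_family_length U t b m (s u : 'I_m -> R) (d : R) :
  open U -> (lebesgue_measure U < d%:E)%E -> itv_family U t b s u ->
  \sum_(i < m) (u i - s i) < d.
Proof.
move=> oU Ud [sub tI sU]; rewrite -lte_fin; apply: le_lt_trans Ud.
have mI (i : 'I_m) : measurable `]s i, u i[%classic by exact: measurable_itv.
have -> : (\sum_(i < m) (u i - s i))%:E =
    (\sum_(i < m) @lebesgue_measure R `]s i, u i[%classic)%E.
  rewrite -sumEFin; apply: eq_bigr => i _.
  rewrite lebesgue_measure_itv /= lte_fin; case: ltP => us; first by rewrite EFinB.
  have [_ [su _]] := sub i.
  have -> : s i = u i by apply/eqP; rewrite eq_le us su.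
  by rewrite subrr.
have := @measure_bigsetU_ord _ _ _ (@lebesgue_measure R) m xpredT _ mI tI.
move=> <-; apply: le_measure; rewrite ?inE.
- by apply: bigsetU_measurable => i _; exact: mI.
- exact: measurable_realfun.open_measurable.
- by elim/big_ind : _ => // X Y XU YU z [/XU|/YU].
Qed.

(* The supremum argument runs from right to left, since only the differences
   g t - g (t - h) are controlled. *)
Lemma ac_nonincreasing g (a b : R) N :
  a <= b -> absolutely_continuous a b (g : R -> R^o) ->
  (@lebesgue_measure R).-negligible N ->
  (forall t, a < t <= b -> ~ N t -> forall e, 0 < e ->
     exists2 d, 0 < d & forall h, 0 < h < d -> g t - g (t - h) <= e * h) ->
  g b <= g a.
Proof.
move=> ab acg [A [mA A0 NA]] dini.
(* The three terms come from slope at most [e] off the exceptional set, increments across intervals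
   covering that set, and the slack [v] below. *)
suff small e : 0 < e -> g b - g a <= e * (b - a) + e + e.
  rewrite -subr_le0; apply/ler_addgt0Pr => e e0; rewrite add0r.
  have c0 : 0 < b - a + 2 by lra.
  have := small (e / (b - a + 2)) (divr_gt0 e0 c0).
  suff -> : forall k, k * (b - a) + k + k = k * (b - a + 2).
    by rewrite divfK // gt_eqF.
  by move=> k; ring.
move=> e0.
(* The exceptional set is covered by an open [U] of measure below this [d], so increments over
   disjoint intervals inside [U] sum to less than [e]. *)
have [d d0 acgd] := acg _ e0.
have [|U [oU AU muU]] := lebesgue_regularity_outer mA _ d0.
  by rewrite [X in (X < _)%E]A0.
have Ud : (lebesgue_measure U < d%:E)%E.
  apply: le_lt_trans muU.
  have UAA : U `<=` (U `\` A) `|` A.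
    by move=> z Uz; have [?|?] := pselect (A z); [right | left].
  have mU : measurable (U : set R) by exact: measurable_realfun.open_measurable.
  have mUA : measurable (U `\` A : set R) by exact: measurableD.
  apply: (@le_trans _ _ (lebesgue_measure ((U `\` A) `|` A))).
    by apply: le_measure => //; rewrite inE //; exact: measurableU.
  have := measureU2 (@lebesgue_measure R) mUA mA.
  by rewrite [X in (_ <= _ + X)%E]A0 adde0.
(* The slack [v] lets the set [B] of good starting points contain its infimum. *)
pose fam t v := exists m (s u : 'I_m -> R), itv_family U t b s u /\
  g b - g t <= e * (b - t) + \sum_(i < m) `|g (u i) - g (s i)| + v.
pose B := [set t | a <= t <= b /\ forall v, 0 < v -> fam t v].
have Bb : B b.
  split; first by rewrite ab lexx.
  move=> v v0; exists 0, (fun=> b), (fun=> b); split.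
    by split; [case|move=> [] |case].
  by rewrite big_ord0 !subrr mulr0 !add0r ltW.
have lB : has_lbound B by exists a => t [/andP[]].
pose t0 := inf B.
have at0 : a <= t0 by apply: lb_le_inf; [exists b | move=> t [/andP[]]].
have t0b : t0 <= b by apply: ge_inf.
(* Half of [v] goes to a nearby point of [B], the other half to the continuity of [g] at [t0]. *)
have Bt0 : B t0.
  split=> [|v v0]; first by rewrite at0.
  have [c c0 acgc] := acg _ (divr_gt0 v0 (ltr0Sn R 1)).
  have [t Bt tt0] := inf_adherent c0 (conj (ex_intro _ _ Bb) lB).
  have t0t : t0 <= t by apply: ge_inf.
  have [/andP[_ tb] /(_ _ (divr_gt0 v0 (ltr0Sn R 1)))[m [s [u [fsu gbt]]]]] := Bt.
  exists m, s, u; split; first exact: itv_family_weaken fsu.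
  have gtt0 : `|g t - g t0| < v / 2.
    have := acgc 1%N (fun=> t0) (fun=> t); rewrite !big_ord1; apply.
    - by [].
    - by move=> i j _ _ _; rewrite !ord1.
    - by move: tt0; rewrite /t0; lra.
  have := ler_norm (g t - g t0).
  have : e * (b - t) <= e * (b - t0) by rewrite ler_pM2l //; lra.
  lra.
have [at0'|t0a] := ltP a t0; last first.
  have e_t0 : t0 = a by apply/eqP; rewrite eq_le t0a at0.
  have [_ /(_ _ e0)[m [s [u [fsu gba]]]]] := Bt0.
  have sl := itv_family_length oU Ud fsu.
  have [sub tI _] := fsu; rewrite e_t0 in sub gba.
  by have := acgd _ _ _ sub tI sl; lra.
(* If a < t0, a good point further left contradicts the choice of [t0] as an infimum. *)
suff [h /andP[h0 ht0] Bh] : exists2 h, 0 < h <= t0 - a & forall v, 0 < v -> fam (t0 - h) v.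
  have : B (t0 - h) by split => //; apply/andP; split; lra.
  by move=> /(ge_inf lB); rewrite -/t0; lra.
have [_ Bt0v] := Bt0.
(* At an exceptional point the interval ]t0 - h, t0[ lies in [U] and joins the family; elsewhere the
   bound on left differences pays for it with slope [e]. *)
have [Nt0|Nt0] := pselect (N t0).
  have /(nbhs_ballP) [r r0 rU] : nbhs t0 U.
    by apply: open_nbhs_nbhs; split => //; exact/AU/NA.
  exists (Num.min r (t0 - a)); first by rewrite lt_min r0 subr_gt0 at0' ge_min lexx orbT.
  set h := Num.min _ _; have h0 : 0 < h by rewrite lt_min r0 subr_gt0.
  have hr : h <= r by rewrite ge_min lexx.
  move=> v v0; have [m [s [u [fsu gbt]]]] := Bt0v _ v0.
  do 3 eexists; split.
    apply: (itv_family_cons _ t0b _ fsu); first by lra.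
    move=> z; rewrite /= in_itv /= => /andP[z1 z2]; apply: rU.
    by rewrite /ball /= gtr0_norm; lra.
  rewrite big_ord_recl unlift_none /=.
  under eq_bigr do rewrite liftK /=.
  have := ler_norm (g t0 - g (t0 - h)).
  have : e * (b - t0) <= e * (b - (t0 - h)) by rewrite ler_pM2l //; lra.
  lra.
have [|r r0 rg] := dini t0 _ Nt0 _ e0; first by rewrite at0'.
exists (Num.min (r / 2) (t0 - a)).
  by rewrite lt_min divr_gt0 // subr_gt0 at0' ge_min lexx orbT.
set h := Num.min _ _; have h0 : 0 < h by rewrite lt_min divr_gt0 // subr_gt0.
have hr : h <= r / 2 by rewrite ge_min lexx.
move=> v v0; have [m [s [u [fsu gbt]]]] := Bt0v _ v0.
exists m, s, u; split; first by apply: itv_family_weaken fsu; lra.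
have : g t0 - g (t0 - h) <= e * h by apply: rg; rewrite h0; lra.
have -> : e * (b - (t0 - h)) = e * (b - t0) + e * h by ring.
lra.
Qed.

End absolutely_continuous_monotone.

(** * Convex Lyapunov functionals *)

Section lyapunov.
Context (R : realType).

Definition subgradient n (H : 'cV[R]_n -> R) (z : 'cV[R]_n) (p : 'I_n -> R) :=
  forall y : 'cV[R]_n, H z + \sum_i p i * (y i ord0 - z i ord0) <= H y.

Lemma coord_le_norm n (z : 'cV[R]_n) i : `|z i ord0| <= `|z|.
Proof.
rewrite [leRHS]/Num.Def.normr /= mx_normrE.
exact: (le_bigmax _ (fun k : 'I_n * 'I_1 => `|z k.1 k.2|) (i, ord0)).
Qed.

Lemma derivable_left n (x : R -> 'cV[R]_n) t e : derivable x t 1 -> 0 < e ->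
  exists2 d, 0 < d & forall h, 0 < h < d -> forall i,
    `|x t i ord0 - x (t - h) i ord0 - h * derive1 x t i ord0| <= e * h.
Proof.
rewrite derive1E => dx e0.
have /cvgrPdist_le/(_ _ e0)[/= r r0 rP] :
  (fun h => h^-1 *: ((x \o shift t) (h *: 1) - x t)) @ 0^' --> 'D_1 x t := dx.
exists r => // h /andP[h0 hr] i.
have := rP (- h); rewrite /ball_ /= sub0r opprK gtr0_norm // => /(_ hr).
rewrite oppr_eq0 gt_eqF // => /(_ isT) le_e.
have := le_trans (coord_le_norm _ i) le_e.
rewrite !mxE [(- h *: 1)]mulr1 [- h + t]addrC => {}le_e.
rewrite -[in leRHS](gtr0_norm h0) -ler_pdivrMr ?normr_gt0 ?gt_eqF // -normf_div.
rewrite -normrN; apply: le_trans le_e; rewrite le_eqVlt; apply/orP; left.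
apply/eqP; congr (`| _ |); field; lra.
Qed.

(** The subgradient inequality at x(t), tested at the earlier point x(t - h), bounds H(x(t)) - H(x(t
    - h)) from above. One suitable subgradient thus controls left differences, and no chain rule is
    needed. The Lipschitz bound makes the composite absolutely continuous. *)
Lemma lyapunov_decrease n (Phi : 'cV[R]_n -> set 'cV[R]_n) x H K c :
  inclusion_solution Phi x -> 0 <= K ->
  (forall z y, H z - H y <= K * `|z - y|) ->
  (forall t, 0 <= t -> forall v, Phi (x t) v ->
     exists2 p, subgradient H (x t) p & \sum_i p i * v i ord0 <= c) ->
  forall a b, 0 <= a -> a <= b -> H (x b) - H (x a) <= c * (b - a).
Proof.
move=> [acx aex] K0 HK decH a b a0 ab.
pose g t := H (x t) - c * t.
suff : g b <= g a by rewrite /g mulrBr; lra.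
apply: (ac_nonincreasing ab _ aex).
  move=> e e0.
  have K1 : 0 < 2 * (K + 1) by lra.
  have c1 : 0 < 2 * (`|c| + 1) by have := normr_ge0 c; lra.
  have [d d0 acd] := acx a b a0 ab _ (divr_gt0 e0 K1).
  (* Each half of [e] pays for one part of the increment of [g]: the Lipschitz part and the linear
     part. Adding 1 keeps the denominators positive. *)
  exists (Num.min d (e / (2 * (`|c| + 1)))).
    by rewrite lt_min d0 divr_gt0.
  move=> m s u su tI; rewrite lt_min => /andP[/(acd _ _ _ su tI) sx sl].
  apply: (@le_lt_trans _ _ (\sum_i (K * `|x (u i) - x (s i)| + `|c| * (u i - s i)))).
    apply: ler_sum => i _; have [_ [sui _]] := su i.
    have -> : g (u i) - g (s i) = H (x (u i)) - H (x (s i)) - c * (u i - s i).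
      by rewrite /g; ring.
    apply: le_trans (ler_normB _ _) _; apply: lerD.
      rewrite ler_norml HK andbT lerNl opprB distrC; exact: HK.
    by rewrite normrM (ger0_norm (_ : 0 <= u i - s i)) // subr_ge0.
  rewrite big_split /= -!mulr_sumr.
  set S1 := \sum_i _ in sx *; set S2 := \sum_i _ in sl *.
  have S10 : 0 <= S1 by apply: sumr_ge0.
  have S20 : 0 <= S2 by apply: sumr_ge0 => i _; rewrite subr_ge0; have [_ []] := su i.
  move: sx sl; rewrite !ltr_pdivlMr // => sx sl.
  have := normr_ge0 c; nra.
move=> t /andP[a_t tb] Nt e e0.
have t0 : 0 <= t by lra.
have [dx /(decH _ t0)[p pH pv]] : derivable x t 1 /\ Phi (x t) (derive1 x t).
  by apply: contrapT => nP; apply: Nt => /= /(_ t0).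
(* Coordinate errors of size e h / (P + 1), weighted by |p_i|, add up to at most e h. *)
pose P := \sum_i `|p i|.
have P0 : 0 <= P by apply: sumr_ge0.
have P1 : 0 < P + 1 by lra.
have [d d0 dxd] := derivable_left dx (divr_gt0 e0 P1).
exists d => // h hd; have [h0 _] := andP hd.
have -> : g t - g (t - h) = H (x t) - H (x (t - h)) - c * h by rewrite /g; ring.
have := pH (x (t - h)).
suff : - \sum_i p i * (x (t - h) i ord0 - x t i ord0) <= c * h + e * h by lra.
rewrite -sumrN.
apply: (@le_trans _ _ (\sum_i (p i * derive1 x t i ord0 * h + `|p i| * (e / (P + 1) * h)))).
  apply: ler_sum => i _.
  have := ler_wpM2l (normr_ge0 (p i)) (dxd _ hd i); rewrite -normrM => /(le_trans (ler_norm _)).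
  lra.
rewrite big_split /= -!mulr_suml -/P; apply: lerD; first by rewrite ler_pM2r.
rewrite mulrA ler_pM2r // mulrCA ler_piMr ?(ltW e0) // ler_pdivrMr //; lra.
Qed.

End lyapunov.

(** * Maxima of partial coordinate sums, and rankings *)

Section maxsum.
Context (R : realType) (n : nat).
Implicit Types (x y z w : 'cV[R]_n) (T U : {set 'I_n}) (F : {set {set 'I_n}}) (l : R).

Lemma subgradient_sum m (c : 'I_m -> R) (H : 'I_m -> 'cV[R]_n -> R)
    (p : 'I_m -> 'I_n -> R) z :
  (forall k, 0 <= c k) -> (forall k, subgradient (H k) z (p k)) ->
  subgradient (fun y => \sum_k c k * H k y) z (fun i => \sum_k c k * p k i).
Proof.
move=> c0 pH y /=; under [X in _ + X <= _]eq_bigr do rewrite mulr_suml.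
rewrite [X in _ + X <= _]exchange_big -big_split /=; apply: ler_sum => k _.
under eq_bigr do rewrite -mulrA.
rewrite -mulr_sumr -mulrDr; exact: ler_wpM2l (c0 k) _ _ (pH k y).
Qed.

Definition setsum l z T := \sum_(i in T) (z i ord0 - l).

(** [T0] is only the default value of the iterated maximum; when it belongs to [F] this is the true
    maximum over [F]. *)
Definition maxsum T0 (F : {set {set 'I_n}}) l z :=
  \big[Num.max/setsum l z T0]_(T in F) setsum l z T.

Lemma setsum_le_maxsum T0 F l z T : T \in F -> setsum l z T <= maxsum T0 F l z.
Proof. by move=> TF; apply: (le_bigmax_cond _ (fun T => setsum l z T) TF). Qed.

Lemma maxsum_le T0 F l z v : T0 \in F ->
  (forall T, T \in F -> setsum l z T <= v) -> maxsum T0 F l z <= v.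
Proof. by move=> T0F Fv; apply: bigmax_le => //; exact: Fv. Qed.

Lemma maxsum_lipschitz T0 F l y z : T0 \in F ->
  maxsum T0 F l y - maxsum T0 F l z <= n%:R * `|y - z|.
Proof.
move=> T0F; rewrite lerBlDr; apply: maxsum_le => // T TF.
rewrite addrC -lerBlDl.
apply: (@le_trans _ _ (setsum l y T - setsum l z T)).
  by rewrite lerB // setsum_le_maxsum.
rewrite -sumrB; apply: (@le_trans _ _ (\sum_(i in T) `|y - z|)).
  apply: ler_sum => i _; apply: le_trans (coord_le_norm (y - z) i).
  rewrite !mxE; apply: le_trans (ler_norm _); lra.
rewrite sumr_const -[X in X <= _]mulr_natl ler_wpM2r // ler_nat.
by rewrite -[leqRHS]card_ord max_card.
Qed.

(** For a maximum of affine functions, the gradient of an active one is a subgradient; here that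
    gradient is an indicator. *)
Lemma maxsum_subgradient T0 F l z T : T0 \in F -> T \in F ->
  (forall T', T' \in F -> setsum l z T' <= setsum l z T) ->
  subgradient (maxsum T0 F l) z (fun i => (i \in T)%:R).
Proof.
move=> T0F TF Tmax y; apply: le_trans (setsum_le_maxsum T0 l y TF).
have : maxsum T0 F l z <= setsum l z T by apply: maxsum_le.
suff -> : setsum l y T = setsum l z T +
    \sum_i (i \in T)%:R * (y i ord0 - z i ord0) by rewrite lerD2r.
have -> : \sum_i (i \in T)%:R * (y i ord0 - z i ord0) =
    \sum_(i in T) (y i ord0 - z i ord0).
  by rewrite [RHS]big_mkcond; apply: eq_bigr => i _; case: ifP; rewrite ?mul1r ?mul0r.
by rewrite -big_split /=; apply: eq_bigr => i _; ring.
Qed.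

(* Comparison with the Lagrange multiplier m of the cardinality constraint. *)
Lemma setsum_threshold l m z T U :
  (forall i, i \in U -> m <= z i ord0 - l) ->
  (forall i, i \notin U -> z i ord0 - l <= m) ->
  m * #|T|%:R <= m * #|U|%:R -> setsum l z T <= setsum l z U.
Proof.
move=> Um mU mTU.
have e V : setsum l z V = \sum_(i in V) (z i ord0 - l - m) + m * #|V|%:R.
  rewrite /setsum -[in m * _]sum1_card natr_sum mulr_sumr -big_split /=.
  by apply: eq_bigr => i _; rewrite mulr1 subrK.
rewrite !e; apply: lerD => //.
rewrite (big_mkcond (mem T)) (big_mkcond (mem U)) /=; apply: ler_sum => i _.
case: ifPn => iT; case: ifPn => iU //.
  by have := mU _ iU; lra.
by have := Um _ iU; lra.
Qed.

Definition comonotone x w := forall i j, x i ord0 < x j ord0 -> w i ord0 <= w j ord0.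

(** Comonotonicity leaves [w] free where [x] has ties, so the nodes are sorted lexicographically, by
    [x] and then by [w]. *)
Lemma ranking x w (r : 'I_n) : comonotone x w ->
  exists s : seq 'I_n, [/\ uniq s, size s = n, (forall i, i \in s) &
    forall k l : nat, (k <= l < n)%N -> x (nth r s l) ord0 <= x (nth r s k) ord0 /\
      w (nth r s l) ord0 <= w (nth r s k) ord0].
Proof.
move=> xw.
pose le i j := (x j ord0 < x i ord0) || (x j ord0 == x i ord0) && (w j ord0 <= w i ord0).
have ltot : total le.
  move=> i j; rewrite /le; case: ltgtP => //= _; exact: le_total.
have lrefl : reflexive le by move=> i; rewrite /le eqxx lexx orbT.
have ltrans : transitive le.
  move=> j i k; rewrite /le => /orP[ij|/andP[/eqP ij wij]] /orP[jk|/andP[/eqP jk wjk]].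
  - by rewrite (lt_trans jk ij).
  - by rewrite jk ij.
  - by rewrite -ij jk.
  - by rewrite jk ij eqxx (le_trans wjk wij) orbT.
have leP i j : le i j -> x j ord0 <= x i ord0 /\ w j ord0 <= w i ord0.
  rewrite /le => /orP[ij|/andP[/eqP -> ->]]; last by [].
  by split; [exact: ltW | exact: xw].
exists (sort le (enum 'I_n)); split.
- by rewrite sort_uniq enum_uniq.
- by rewrite size_sort size_enum_ord.
- by move=> i; rewrite mem_sort mem_enum.
- move=> k l /andP[kl ln]; apply: leP.
  apply: (sorted_leq_nth ltrans lrefl r (sort_sorted ltot (enum 'I_n))) => //.
    by rewrite inE size_sort size_enum_ord (leq_ltn_trans kl).
  by rewrite inE size_sort size_enum_ord.
Qed.

End maxsum.

(** * Flow through a cut of the digraph *)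

Section network.
Context (R : realType) (n : nat) (G : weightedDigraph R n).
Implicit Types (x y z w : 'cV[R]_n) (T U P : {set 'I_n}).

Definition flow w i := \sum_j adjacency G i j * (w j ord0 - w i ord0).

Lemma laplacian_flow w i : (- (laplacian G *m w)) i ord0 = flow w i.
Proof.
rewrite /laplacian mulmxBl !mxE opprB /flow.
under [RHS]eq_bigr do rewrite mulrBr.
rewrite sumrB -mulr_suml; congr (_ - _).
rewrite (bigD1 i) //= big1 ?addr0 ?mxE ?eqxx ?mulr1n ?mxE //.
by move=> j ji; rewrite !mxE eq_sym (negbTE ji) mulr0n mul0r.
Qed.

(** No flow enters such a set from outside. The instances used are the set of all nodes and the set
    of roots. *)
Definition in_closed P := forall i j, i \in P -> edge G j i -> j \in P.

Lemma adjacency_nedge i j : ~~ edge G j i -> adjacency G i j = 0.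
Proof.
rewrite -(adjacency_gt0 G) -leNgt => a0; apply/eqP.
by rewrite eq_le a0 adjacency_ge0.
Qed.

(** Written as a [maxsum] over singletons at level 0, so that its Lipschitz and subgradient
    properties are inherited. *)
Definition coord_max P (i0 : 'I_n) : 'cV[R]_n -> R :=
  maxsum [set i0]%SET [set [set i]%SET | i in P]%SET 0.

Lemma setsum1 l z i : setsum l z [set i]%SET = z i ord0 - l.
Proof. by rewrite /setsum big_set1. Qed.

Lemma le_coord_max P i0 z i : i \in P -> z i ord0 <= coord_max P i0 z.
Proof.
move=> iP; rewrite -[leLHS]subr0 -setsum1; apply: setsum_le_maxsum.
exact: imset_f.
Qed.

Lemma coord_max_le P i0 z v : i0 \in P ->
  (forall i, i \in P -> z i ord0 <= v) -> coord_max P i0 z <= v.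
Proof.
move=> i0P zv; apply: maxsum_le; first exact: imset_f.
by move=> _ /imsetP [i iP ->]; rewrite setsum1 subr0 zv.
Qed.

(* Among the maximizers of x, one with maximal w can only flow downwards. *)
Lemma coord_max_decrease P i0 x w : in_closed P -> i0 \in P -> comonotone x w ->
  exists2 p, subgradient (coord_max P i0) x p & \sum_i p i * flow w i <= 0.
Proof.
move=> clP i0P xw.
case: (@arg_maxP _ _ _ i0 (mem P) (fun i => x i ord0) i0P) => i1 i1P i1max.
pose E := [pred i | (i \in P) && (x i ord0 == x i1 ord0)].
have i1E : E i1 by rewrite /E /= eqxx andbT.
case: (@arg_maxP _ _ _ i1 E (fun i => w i ord0) i1E) => k /andP[kP /eqP xk] kmax.
exists (fun i => (i \in [set k]%SET)%:R).
  apply: maxsum_subgradient; rewrite ?imset_f // => _ /imsetP [j jP ->].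
  by rewrite !setsum1 !subr0 xk; exact: i1max.
rewrite (bigD1 k) //= big1 ?addr0 => [|j jk]; last by rewrite inE (negbTE jk) mul0r.
rewrite inE eqxx mul1r; apply: sumr_le0 => j _.
have [jk|/adjacency_nedge ->] := boolP (edge G j k); last by rewrite mul0r.
apply: mulr_ge0_le0; first exact: adjacency_ge0.
have jP := clP _ _ kP jk; rewrite subr_le0.
have xj : x j ord0 <= x i1 ord0 := i1max j jP.
have [xlt|xge] := ltP (x j ord0) (x i1 ord0); first by apply: xw; rewrite xk.
by apply: kmax; rewrite /E /= jP eq_le xj.
Qed.

(** Follow the path from [r] until it first enters [T]. *)
Lemma crossing_edge T (r : 'I_n) i : connect (edge G) r i -> r \notin T -> i \in T ->
  exists k j, [/\ k \in T, j \notin T & edge G j k].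
Proof.
move=> /connectP [p + ->]; elim: p r => [|k p IHp] r /=.
  by move=> _ /negbTE ->.
move=> /andP[rk kp] rT lT; have [kT|kT] := boolP (k \in T).
  by exists k, r.
exact: IHp kp kT lT.
Qed.

Definition total_weight := \sum_i \sum_j adjacency G i j.

Lemma total_weight_ge0 : 0 <= total_weight.
Proof. by apply: sumr_ge0 => i _; apply: sumr_ge0 => j _; exact: adjacency_ge0. Qed.

Definition min_weight (a : R) := forall i j, edge G j i -> a <= adjacency G i j.

Lemma min_weight_exists : exists2 a, 0 < a & min_weight a.
Proof.
(* The default 1 keeps the minimum positive when there are no edges. *)
exists (\big[Num.min/1]_(ij : 'I_n * 'I_n | edge G ij.2 ij.1) adjacency G ij.1 ij.2).
  by apply: lt_bigmin => // -[i j] /=; rewrite adjacency_gt0.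
move=> i j ij.
by apply: (bigmin_le_cond _ (fun ij => adjacency G ij.1 ij.2)
  (_ : edge G (i, j).2 (i, j).1)).
Qed.

(** Every term of the flow into [T] is at most its weight times [hi - mid], and the crossing edge
    from [j] to [k] contributes at most [- a * (mid - lo)]. *)
Lemma cut_flow T w a hi mid lo k j : min_weight a ->
  k \in T -> j \notin T -> edge G j k ->
  (forall i, i \in T -> mid <= w i ord0 <= hi) ->
  (forall i, i \notin T -> w i ord0 <= lo) -> lo <= mid ->
  \sum_(i in T) flow w i <= total_weight * (hi - mid) - a * (mid - lo).
Proof.
move=> amin kT jT jk wT wNT lomid.
have midhi : mid <= hi by have /andP[] := wT _ kT; exact: le_trans.
have term i l : i \in T ->
    adjacency G i l * (w l ord0 - w i ord0) <= adjacency G i l * (hi - mid).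
  move=> iT; apply: ler_wpM2l; first exact: adjacency_ge0.
  have /andP[? ?] := wT _ iT.
  by have [/wT/andP[? ?]|/wNT ?] := boolP (l \in T); lra.
have row i : i \in T -> flow w i <= (\sum_l adjacency G i l) * (hi - mid).
  by move=> iT; rewrite mulr_suml; apply: ler_sum => l _; exact: term.
have rowk : flow w k <= (\sum_l adjacency G k l) * (hi - mid) - a * (mid - lo).
  rewrite mulr_suml /flow (bigD1 j) //= [in leRHS](bigD1 j) //=.
  have : \sum_(l | l != j) adjacency G k l * (w l ord0 - w k ord0) <=
         \sum_(l | l != j) adjacency G k l * (hi - mid).
    by apply: ler_sum => l _; exact: term.
  have : adjacency G k j * (w j ord0 - w k ord0) <= adjacency G k j * (lo - mid).
    apply: ler_wpM2l; first exact: adjacency_ge0.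
    by have /andP[? ?] := wT _ kT; have := wNT _ jT; lra.
  have : a * (mid - lo) <= adjacency G k j * (mid - lo).
    by apply: ler_wpM2r; [rewrite subr_ge0 | exact: amin].
  have : 0 <= adjacency G k j * (hi - mid).
    by apply: mulr_ge0; rewrite ?adjacency_ge0 ?subr_ge0.
  lra.
rewrite (bigD1 k) //=.
have : \sum_(i in T | i != k) flow w i <=
    \sum_(i | i != k) (\sum_l adjacency G i l) * (hi - mid).
  rewrite big_mkcondl /=; apply: ler_sum => i _.
  case: ifPn => iT; first exact: row.
  apply: mulr_ge0; rewrite ?subr_ge0 //.
  by apply: sumr_ge0 => l _; exact: adjacency_ge0.
rewrite -mulr_suml => rest.
have -> : total_weight = \sum_l adjacency G k l +
    \sum_(i | i != k) \sum_l adjacency G i l by rewrite /total_weight (bigD1 k).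
rewrite mulrDl; lra.
Qed.

End network.

(** * The weighted rank functional and its decrease *)

Section rank_functional.
Context (R : realType) (n : nat) (G : weightedDigraph R n).
Implicit Types (x w z : 'cV[R]_n) (U : {set 'I_n}) (q l a : R).

(** Allowing at most k + 1 nodes, rather than exactly that many, makes each maximum nonnegative and
    never forces in a node below level [l]. *)
Definition rank_functional q l z :=
  \sum_(k < n) q ^+ k * maxsum finset.set0 [set T : {set 'I_n} | (#|T| <= k.+1)%N]%SET l z.

Lemma card_family0 k : finset.set0 \in [set T : {set 'I_n} | (#|T| <= k)%N]%SET.
Proof. by rewrite inE cards0. Qed.

Lemma rank_functional_ge0 q l z : 0 <= q -> 0 <= rank_functional q l z.
Proof.
move=> q0; apply: sumr_ge0 => k _; apply: mulr_ge0; first exact: exprn_ge0.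
apply: le_trans (setsum_le_maxsum _ _ _ (card_family0 k.+1)).
by rewrite /setsum big_set0.
Qed.

Lemma rank_functional_lipschitz q l y z : 0 <= q ->
  rank_functional q l y - rank_functional q l z <=
    (\sum_(k < n) q ^+ k * n%:R) * `|y - z|.
Proof.
move=> q0; rewrite /rank_functional -sumrB mulr_suml; apply: ler_sum => k _.
rewrite -mulrBr -mulrA; apply: ler_wpM2l; first exact: exprn_ge0.
exact: maxsum_lipschitz (card_family0 _).
Qed.

Definition weight_ratio a := a / (total_weight G + a).

(** The coefficient (C + a) q^n of the term that survives the telescoping. *)
Definition decrease_rate a := (total_weight G + a) * weight_ratio a ^+ n.

Lemma weight_ratio_gt0 a : 0 < a -> 0 < weight_ratio a.
Proof. by move=> a0; rewrite divr_gt0 // ltr_wpDl // total_weight_ge0. Qed.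

Lemma decrease_rate_gt0 a : 0 < a -> 0 < decrease_rate a.
Proof.
move=> a0; apply: mulr_gt0; first by rewrite ltr_wpDl // total_weight_ge0.
exact/exprn_gt0/weight_ratio_gt0.
Qed.

(* With W_0 >= W_1 >= ... the values of w in decreasing order and u = #|U|, the
   (k+1)-st active set consists of the first min(k + 1, u) nodes and the flow into
   it is at most (C + a) d_k - a d_(k+1), where d_k = W_0 - W_min(k, u). *)
Lemma rank_functional_decrease a l x w U (r i : 'I_n) v :
  0 < a -> min_weight G a -> comonotone x w ->
  (forall j, connect (edge G) r j) -> r \notin U -> i \in U ->
  (forall j, j \in U -> l <= x j ord0) -> (forall j, j \notin U -> x j ord0 <= l) ->
  (forall j k, j \in U -> k \notin U -> w k ord0 < w j ord0 \/ x k ord0 < x j ord0) ->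
  (forall j, j \notin U -> w j ord0 <= v) ->
  exists2 p, subgradient (rank_functional (weight_ratio a) l) x p &
    \sum_j p j * flow G w j <= - (decrease_rate a * (w i ord0 - v)).
Proof.
move=> a0 amin xw rroot rU iU lU Ul sep wv.
have q0 := weight_ratio_gt0 a0; set q := weight_ratio a in q0 *.
have [s [us ss sm mono]] := ranking r xw.
pose X k := x (nth r s k) ord0; pose W k := w (nth r s k) ord0.
pose T k : {set 'I_n} := [set j | (index j s < k)%N]%SET.
have idx j : (index j s < n)%N by have := sm j; rewrite -index_mem ss.
have nthK j : nth r s (index j s) = j by rewrite nth_index.
have idxK k : (k < n)%N -> index (nth r s k) s = k.
  by move=> kn; rewrite index_uniq ?ss.
have xX j k : (k <= index j s)%N -> x j ord0 <= X k /\ w j ord0 <= W k.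
  by move=> kj; rewrite -[j in x j]nthK -[j in w j]nthK; apply: mono; rewrite kj idx.
have Xx j k : (index j s <= k < n)%N -> X k <= x j ord0 /\ W k <= w j ord0.
  by move=> jk; rewrite -[j in x j]nthK -[j in w j]nthK; apply: mono.
have cardT k : (k <= n)%N -> #|T k| = k.
  move=> kn; rewrite -[RHS](size_takel (s := s)) ?ss // -(card_uniqP (take_uniq k us)).
  by apply: eq_card => j; rewrite inE in_take.
pose u := #|U|.
have u0 : (0 < u)%N by apply/card_gt0P; exists i.
have un : (u < n)%N.
  rewrite -[ltnRHS]card_ord -cardsT; apply: proper_card; rewrite properE finset.subsetT.
  by apply/fintype.subsetPn; exists r.
(* Otherwise a node outside [U] would be ranked before a node of [U], against the separation
   hypothesis. *)
have TU : T u = U.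
  apply/esym/eqP; rewrite eqEcard cardT ?(ltnW un) // leqnn andbT.
  apply/fintype.subsetP => j jU; apply: contraT; rewrite inE -leqNgt => uj.
  have /fintype.subsetPn [k kT kU] : ~~ (T u \subset U).
    apply/negP => TsubU; have /eqP e : T u == U.
      by rewrite eqEcard TsubU cardT ?(ltnW un) // leqnn.
    by move: jU; rewrite -e inE ltnNge uj.
  rewrite inE in kT.
  have [xjk wjk] : x j ord0 <= x k ord0 /\ w j ord0 <= w k ord0.
    have [? ?] := xX _ _ uj.
    have [? ?] : X u <= x k ord0 /\ W u <= w k ord0 by apply: Xx; rewrite (ltnW kT).
    by split; [exact: (le_trans (y := X u)) | exact: (le_trans (y := W u))].
  by case: (sep _ _ jU kU); rewrite ltNge ?xjk ?wjk.
have cut m : (m < u)%N -> \sum_(j in T m.+1) flow G w j <=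
    total_weight G * (W 0%N - W m) - a * (W m - W m.+1).
  move=> mu.
  (* The set lies inside [U], hence misses the root, and a path from the root to the top node must
     enter it. *)
  have rT : r \notin T m.+1.
    have : r \notin T u by rewrite TU.
    by rewrite !inE -!leqNgt; exact: leq_trans.
  have zT : nth r s 0 \in T m.+1 by rewrite inE idxK // (leq_trans _ un).
  have [k [j [kT jT jk]]] := crossing_edge (rroot _) rT zT.
  have mn : (m.+1 < n)%N by exact: leq_ltn_trans mu un.
  apply: (cut_flow amin kT jT jk).
  - move=> h; rewrite inE => hm.
    have [_ ->] : X m <= x h ord0 /\ W m <= w h ord0.
      by apply: Xx; rewrite -ltnS hm (ltnW mn).
    by have [_ ->] := @xX h 0%N isT.
  - by move=> h; rewrite inE -leqNgt => /xX[].
  - by have [] : X m.+1 <= X m /\ W m.+1 <= W m by apply: mono; rewrite leqnSn.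
pose act k := T (minn k.+1 u).
exists (fun j => \sum_(k < n) q ^+ k * (j \in act k)%:R).
  apply: subgradient_sum => k; first exact/exprn_ge0/ltW.
  have cact : #|act k| = minn k.+1 u.
    by rewrite cardT // geq_min (ltnW un) orbT.
  apply: maxsum_subgradient; [exact: card_family0 | by rewrite inE cact geq_minl |].
  move=> T'; rewrite inE => cT'.
  have [ku|uk] := leqP k.+1 u; last first.
    have -> : act k = U by rewrite /act (minn_idPr (ltnW uk)).
    apply: (@setsum_threshold _ _ _ 0); rewrite ?mul0r // => j jU.
      by rewrite subr_ge0 lU.
    by rewrite subr_le0 Ul.
  have eact : act k = T k.+1 by rewrite /act (minn_idPl ku).
  have kn : (k < n)%N by exact: ltn_ord.
  apply: (@setsum_threshold _ _ _ (X k - l)); rewrite eact.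
  - move=> j; rewrite inE ltnS => jk; rewrite lerD2r.
    by have [] : X k <= x j ord0 /\ W k <= w j ord0 by apply: Xx; rewrite jk.
  - by move=> j; rewrite inE -leqNgt => /ltnW /xX[? _]; rewrite lerD2r.
  - rewrite cardT // ler_wpM2l // ?ler_nat // subr_ge0 lU // -TU inE idxK //.
pose B := total_weight G + a.
have B0 : 0 < B by rewrite ltr_wpDl // total_weight_ge0.
have qB : q * B = a by rewrite /q /weight_ratio divfK // gt_eqF.
pose d k := W 0%N - W (minn k u).
(* For k < u this is [cut] rearranged. For k >= u the active set stays [U] and d_(k+1) = d_k, so the
   bound C d_k suffices, and [cut] at u - 1 gives it. *)
have step (k : 'I_n) : \sum_(j in act k) flow G w j <= B * d k - a * d k.+1.
  rewrite /act /d; have [ku|uk] := ltnP k u.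
    rewrite (minn_idPl ku). apply: le_trans (cut _ ku) _.
    by rewrite /B; lra.
  rewrite (minn_idPr (leqW uk)) -(prednK u0).
  apply: le_trans (cut _ _) _; first by rewrite prednK.
  have [_] : X u.-1.+1 <= X u.-1 /\ W u.-1.+1 <= W u.-1.
    by apply: mono; rewrite leqnSn prednK.
  move=> Wu; have : total_weight G * W u.-1.+1 <= total_weight G * W u.-1.
    by rewrite ler_wpM2l // total_weight_ge0.
  have : a * W u.-1.+1 <= a * W u.-1 by rewrite ler_pM2l.
  rewrite /B; lra.
under eq_bigr do rewrite mulr_suml.
rewrite exchange_big /=.
apply: (@le_trans _ _ (\sum_(k < n) (q ^+ k * B * d k - q ^+ k.+1 * B * d k.+1))).
  apply: ler_sum => k _.
  have -> : \sum_j q ^+ k * (j \in act k)%:R * flow G w j =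
      q ^+ k * \sum_(j in act k) flow G w j.
    rewrite [in RHS]big_mkcond mulr_sumr; apply: eq_bigr => j _.
    by case: ifP; rewrite ?mulr1 ?mulr0 ?mul0r.
  have -> : q ^+ k * B * d k - q ^+ k.+1 * B * d k.+1 = q ^+ k * (B * d k - a * d k.+1).
    by rewrite -qB exprS; ring.
  by apply: ler_wpM2l (step k); exact/exprn_ge0/ltW.
rewrite -(big_mkord xpredT (fun k => q ^+ k * B * d k - q ^+ k.+1 * B * d k.+1)).
rewrite -[leLHS]opprK -sumrN; under eq_bigr do rewrite opprB.
(* Here d_0 = 0 and d_n = W_0 - W_u, with W_0 >= w_i, and W_u <= v because the node of rank [u] lies
   outside [U]. *)
rewrite telescope_sumr // lerN2 expr0 /d min0n subrr mulr0 subr0 (minn_idPr (ltnW un)).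
rewrite /decrease_rate -/B -/q [B * _]mulrC ler_pM2l; last by rewrite mulr_gt0 ?exprn_gt0.
apply: lerB; first by have [] := @xX i 0%N isT.
by apply: wv; rewrite -TU inE idxK // ltnn.
Qed.

End rank_functional.

(** * Limits along a solution *)

Section trajectories.
Context (R : realType) (n : nat) (G : weightedDigraph R n).
Implicit Types (f : R -> R) (x : R -> 'cV[R]_n) (z w : 'cV[R]_n).

Lemma filippov_prod_comonotone f z w : {homo f : u v / u <= v} ->
  filippov_prod f z w -> comonotone z w.
Proof. by move=> fm fw i j; apply: filippov_comonotone fm (fw i) (fw j). Qed.

Lemma solution_decrease f x (H : 'cV[R]_n -> R) K c :
  inclusion_solution (consensus_rhs G f) x -> 0 <= K ->
  (forall z y, H z - H y <= K * `|z - y|) ->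
  (forall t : R, 0 <= t -> forall w, filippov_prod f (x t) w ->
     exists2 p, subgradient H (x t) p & \sum_i p i * flow G w i <= c) ->
  forall a b, 0 <= a -> a <= b -> H (x b) - H (x a) <= c * (b - a).
Proof.
move=> sol K0 HK decH; apply: (lyapunov_decrease sol K0 HK) => t t0 _ [w fw <-].
have [p pH pc] := decH t t0 w fw; exists p => //.
by under eq_bigr do rewrite laplacian_flow.
Qed.

Lemma inclusion_solution_reflect f x : {homo f : u v / u <= v} ->
  inclusion_solution (consensus_rhs G f) x ->
  inclusion_solution (consensus_rhs G (fun u => - f (- u))) (fun t => - x t).
Proof.
move=> fm [acx aex]; split.
  move=> a b a0 ab e e0; have [d d0 acd] := acx a b a0 ab e e0.
  exists d => // m s u su tI sl.
  by under eq_bigr do rewrite -opprD normrN; exact: acd.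
apply: (negligibleS _ aex) => t nP xt; apply: nP => t0; have [dx [w fw dxw]] := xt t0.
split; first exact: derivableN.
exists (- w); first by move=> i; rewrite !mxE; exact: filippov_reflect.
by rewrite derive1E deriveN // -derive1E -dxw mulmxN.
Qed.

Lemma coord_max_attained (P : {set 'I_n}) i0 z : i0 \in P ->
  exists2 i, i \in P & coord_max P i0 z = z i ord0.
Proof.
move=> i0P; case: (@arg_maxP _ _ _ i0 (mem P) (fun i => z i ord0) i0P) => i iP imax.
exists i => //; apply/eqP; rewrite eq_le le_coord_max // andbT.
exact: coord_max_le.
Qed.

Lemma coord_max_nonincreasing f x (P : {set 'I_n}) i0 : {homo f : u v / u <= v} ->
  inclusion_solution (consensus_rhs G f) x -> in_closed G P -> i0 \in P ->
  forall a b, 0 <= a -> a <= b -> coord_max P i0 (x b) <= coord_max P i0 (x a).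
Proof.
move=> fm sol clP i0P a b a0 ab; rewrite -subr_le0 -(mul0r (b - a)).
apply: (solution_decrease (K := n%:R) sol) => // [z y|t t0 w fw].
  exact/maxsum_lipschitz/imset_f.
apply: coord_max_decrease => //; exact: filippov_prod_comonotone fw.
Qed.

(** The maximum over [P] is nonincreasing, and bounded below because, by reflection, the minimum
    over all nodes is nondecreasing; [M] is its infimum. *)
Lemma top_limit f x (P : {set 'I_n}) i0 : {homo f : u v / u <= v} ->
  inclusion_solution (consensus_rhs G f) x -> in_closed G P -> i0 \in P ->
  exists M : R, (forall t : R, 0 <= t -> exists2 i, i \in P & M <= x t i ord0) /\
    (forall e : R, 0 < e -> exists2 T : R, 0 <= T &
       forall t : R, T <= t -> forall i, i \in P -> x t i ord0 < M + e).
Proof.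
move=> fm sol clP i0P.
have decP := coord_max_nonincreasing fm sol clP i0P.
have clT : in_closed G finset.setT by move=> i j _ _; rewrite inE.
have decT := coord_max_nonincreasing (homo_reflect fm)
  (inclusion_solution_reflect fm sol) clT (finset.in_setT i0).
pose S := [set coord_max P i0 (x t) | t in [set t | 0 <= t]].
have S0 : S (coord_max P i0 (x 0)) by exists 0 => //=.
have lbS : has_lbound S.
  exists (- coord_max finset.setT i0 (- x 0)) => _ [t /= t0 <-].
  apply: le_trans (le_coord_max _ _ i0P); rewrite lerNl.
  apply: le_trans (decT 0 t (lexx _) t0).
  by have := le_coord_max i0 (- x t) (finset.in_setT i0); rewrite mxE.
exists (inf S); split=> [t t0|e e0].
  have [i iP e] := coord_max_attained (x t) i0P; exists i => //; rewrite -e.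
  by apply: ge_inf => //; exists t.
have [_ [T /= T0 <-] Te] := inf_adherent e0 (conj (ex_intro _ _ S0) lbS).
exists T => // t Tt i iP; apply: le_lt_trans Te.
exact: le_trans (le_coord_max i0 (x t) iP) (decP _ _ T0 Tt).
Qed.

Lemma bottom_limit f x (P : {set 'I_n}) i0 : {homo f : u v / u <= v} ->
  inclusion_solution (consensus_rhs G f) x -> in_closed G P -> i0 \in P ->
  exists M : R, (forall t : R, 0 <= t -> exists2 i, i \in P & x t i ord0 <= M) /\
    (forall e : R, 0 < e -> exists2 T : R, 0 <= T &
       forall t : R, T <= t -> forall i, i \in P -> M - e < x t i ord0).
Proof.
move=> fm sol clP i0P.
have [M [ge_M lt_M]] := top_limit (homo_reflect fm)
  (inclusion_solution_reflect fm sol) clP i0P.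
exists (- M); split=> [t /ge_M[i iP]|e /lt_M[T T0 TM]].
  by rewrite mxE lerNr; exists i.
by exists T => // t /TM tM i /tM; rewrite mxE; lra.
Qed.

(** With c < 0, the bound at time (H(0) + 1) / (-c) would give a value at most -1. *)
Lemma nonneg_rate (H : R -> R) c : (forall t : R, 0 <= H t) ->
  (forall t : R, 0 <= t -> H t - H 0 <= c * (t - 0)) -> 0 <= c.
Proof.
move=> H0 Hc; rewrite leNgt; apply/negP => c0.
have t0 : 0 <= (H 0 + 1) / - c by rewrite divr_ge0 ?oppr_ge0 ?(ltW c0) // addr_ge0.
have := Hc _ t0; have := H0 ((H 0 + 1) / - c).
have -> : c * ((H 0 + 1) / - c - 0) = - (H 0 + 1) by field; rewrite lt_eqF.
lra.
Qed.

Definition is_root r := forall j, connect (edge G) r j.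

(** The nodes above level [y] miss a root and include one at height at least [M], where w >= f(y2);
    the other nodes have w <= f(y1). The rank functional thus decreases at a rate proportional to
    f(y2) - f(y1), and being nonnegative it forbids a positive rate. *)
Lemma constant_above f x y M y1 y2 : {homo f : u v / u <= v} ->
  inclusion_solution (consensus_rhs G f) x ->
  (forall t : R, 0 <= t -> exists2 r, is_root r & x t r ord0 <= y) ->
  (forall t : R, 0 <= t -> exists i, M <= x t i ord0) ->
  y < y1 -> y1 <= y2 -> y2 < M -> f y2 <= f y1.
Proof.
move=> fm sol rooty topM yy1 y12 y2M.
have [a a0 amin] := min_weight_exists G.
have q0 := weight_ratio_gt0 G a0; have d0 := decrease_rate_gt0 G a0.
pose H : 'cV[R]_n -> R := rank_functional (weight_ratio G a) y.
have := @nonneg_rate (H \o x) (- (decrease_rate G a * (f y2 - f y1))).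
rewrite oppr_ge0 pmulr_rle0 // subr_le0; apply.
  by move=> t; apply: rank_functional_ge0; exact: ltW.
move=> t t0; pose K := \sum_(k < n) weight_ratio G a ^+ k * n%:R.
apply: (solution_decrease (K := K) sol _ _ _ (lexx 0) t0).
- by apply: sumr_ge0 => k _; apply: mulr_ge0; first exact/exprn_ge0/ltW.
- by move=> z z'; apply: rank_functional_lipschitz; exact: ltW.
move=> {}t {}t0 w fw.
have [r rr ry] := rooty t t0; have [i Mi] := topM t t0.
have [|||||j|p pH pw] := @rank_functional_decrease R n G a y (x t) w
    [set j | y < x t j ord0]%SET r i (f y1) a0 amin
    (filippov_prod_comonotone fm fw) rr.
- by rewrite inE -leNgt.
- by rewrite inE; lra.
- by move=> j; rewrite inE => /ltW.
- by move=> j; rewrite inE -leNgt.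
- by move=> j k; rewrite !inE -leNgt => yj ky; right; exact: le_lt_trans ky yj.
- rewrite inE -leNgt => jy; apply: (filippov_le fm (fw j)).
  exact: le_lt_trans jy yy1.
exists p => //; apply: le_trans pw _; rewrite lerN2 ler_pM2l // lerD2r.
apply: (filippov_ge fm (fw i)); exact: lt_le_trans y2M Mi.
Qed.

Lemma constant_below f x y M y1 y2 : {homo f : u v / u <= v} ->
  inclusion_solution (consensus_rhs G f) x ->
  (forall t : R, 0 <= t -> exists2 r, is_root r & y <= x t r ord0) ->
  (forall t : R, 0 <= t -> exists i, x t i ord0 <= M) ->
  M < y1 -> y1 <= y2 -> y2 < y -> f y2 <= f y1.
Proof.
move=> fm sol rooty botM My1 y12 y2y.
have := @constant_above _ _ (- y) (- M) (- y2) (- y1) (homo_reflect fm)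
  (inclusion_solution_reflect fm sol).
rewrite !opprK !ltrN2 !lerN2; apply => // t t0.
  by have [r rr yr] := rooty t t0; exists r => //; rewrite mxE lerN2.
by have [i iM] := botM t t0; exists i; rewrite mxE lerN2.
Qed.

End trajectories.

(** * Constancy of the function across a level separating the roots *)

Section conclusion.
Context (R : realType) (n : nat) (G : weightedDigraph R n).
Implicit Types (f : R -> R) (x : R -> 'cV[R]_n) (z w : 'cV[R]_n).

(** The second summand is the mirror image of the first: it weighs depths below [l]. *)
Definition two_sided_functional q l z :=
  rank_functional q l z + rank_functional q (- l) (- z).

Lemma flowN w i : flow G (- w) i = - flow G w i.
Proof. by rewrite /flow -sumrN; apply: eq_bigr => j _; rewrite !mxE; ring. Qed.

Lemma two_sided_decrease q l z w c1 c2 :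
  (exists2 p, subgradient (rank_functional q l) z p &
     \sum_i p i * flow G w i <= c1) ->
  (exists2 p, subgradient (rank_functional q (- l)) (- z) p &
     \sum_i p i * flow G (- w) i <= c2) ->
  exists2 p, subgradient (two_sided_functional q l) z p &
     \sum_i p i * flow G w i <= c1 + c2.
Proof.
move=> [p pH pc] [p' p'H p'c]; exists (fun i => p i - p' i).
  move=> y; apply: le_trans (lerD (pH y) (p'H (- y))).
  rewrite /two_sided_functional addrACA lerD2l -big_split /=.
  by rewrite le_eqVlt; apply/orP; left; apply/eqP/eq_bigr => i _; rewrite !mxE; ring.
apply: le_trans (lerD pc p'c); rewrite -big_split /=.
by rewrite le_eqVlt; apply/orP; left; apply/eqP/eq_bigr => i _; rewrite flowN; ring.
Qed.

(* At a level s separating the roots, either some root has w below the midpoint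
   c of [f y1, f y2], and the nodes with w above c lose height, or all roots are
   above c, and the nodes with w below c gain height. *)
Lemma constant_across f x s m M y1 y2 : {homo f : u v / u <= v} ->
  inclusion_solution (consensus_rhs G f) x ->
  (forall t : R, 0 <= t -> exists2 r, is_root G r & x t r ord0 <= s) ->
  (forall t : R, 0 <= t -> exists2 r, is_root G r & s <= x t r ord0) ->
  (forall t : R, 0 <= t -> exists i, M <= x t i ord0) ->
  (forall t : R, 0 <= t -> exists i, x t i ord0 <= m) ->
  m < y1 -> y1 < s -> s < y2 -> y2 < M ->
  (forall y, y1 <= y -> y < s -> f y <= f y1) ->
  (forall y, s < y -> y <= y2 -> f y2 <= f y) ->
  f y2 <= f y1.
Proof.
move=> fm sol lowr highr topM botm my1 y1s sy2 y2M fl fr.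
have [a a0 amin] := min_weight_exists G.
have q0 := weight_ratio_gt0 G a0; have d0 := decrease_rate_gt0 G a0.
rewrite leNgt; apply/negP => f12.
pose c := (f y1 + f y2) / 2.
have cE : c = (f y1 + f y2) / 2 by [].
pose H : 'cV[R]_n -> R := two_sided_functional (weight_ratio G a) s.
have := @nonneg_rate R (H \o x) (- (decrease_rate G a * ((f y2 - f y1) / 2))).
rewrite oppr_ge0 pmulr_rle0 //.
suff decH : forall t : R, 0 <= t ->
    (H \o x) t - (H \o x) 0 <= - (decrease_rate G a * ((f y2 - f y1) / 2)) * (t - 0).
  move=> /(_ _ decH) H0; have : (f y2 - f y1) / 2 <= 0; last by lra.
  by apply: H0 => t; apply: addr_ge0; apply: rank_functional_ge0; exact: ltW.
move=> t t0; pose K := \sum_(k < n) weight_ratio G a ^+ k * n%:R.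
have K0 : 0 <= K.
  by apply: sumr_ge0 => k _; apply: mulr_ge0; first exact/exprn_ge0/ltW.
apply: (solution_decrease (K := K + K) sol _ _ _ (lexx 0) t0).
- exact: addr_ge0.
- move=> z z'; rewrite /H /two_sided_functional mulrDl opprD addrACA.
  apply: lerD; first by apply: rank_functional_lipschitz; exact: ltW.
  by rewrite -[z - z']opprK normrN opprD; apply: rank_functional_lipschitz; exact: ltW.
move=> {}t {}t0 w fw.
have xw := filippov_prod_comonotone fm fw.
have xwN : comonotone (- x t) (- w).
  by move=> i j; rewrite !mxE ltrN2 lerN2; exact: xw.
(* Compare with [f] at a point strictly between x_i and [s], moved up to [y1] if it lies below. *)
have wl i : x t i ord0 < s -> w i ord0 <= f y1.
  move=> xs; apply: le_trans (fl (Num.max ((x t i ord0 + s) / 2) y1) _ _).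
  - by apply: (filippov_le fm (fw i)); rewrite lt_max; apply/orP; left; lra.
  - by rewrite le_max lexx orbT.
  - by rewrite gt_max y1s andbT; lra.
have wr i : s < x t i ord0 -> f y2 <= w i ord0.
  move=> sx; apply: le_trans (fr (Num.min ((x t i ord0 + s) / 2) y2) _ _) _.
  - by rewrite lt_min sy2 andbT; lra.
  - by rewrite ge_min lexx orbT.
  - by apply: (filippov_ge fm (fw i)); rewrite gt_min; apply/orP; left; lra.
have [iM Mx] := topM t t0; have [im xm] := botm t t0.
have siM : s < x t iM ord0 by lra.
have ims : x t im ord0 < s by lra.
have wM := wr _ siM; have wm := wl _ ims.
have [r1 rr1 r1s] := lowr t t0; have [r2 rr2 r2s] := highr t t0.
have [[r rr rc]|hr] := pselect (exists2 r, is_root G r & w r ord0 < c).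
  (* The first summand supplies the whole rate, as f(y2) - c is half the jump; the second need only
     not increase. *)
  have -> : - (decrease_rate G a * ((f y2 - f y1) / 2)) =
      - (decrease_rate G a * (f y2 - c)) + - (decrease_rate G a * 0).
    by rewrite cE; field.
  apply: two_sided_decrease.
    (* Cutting by [w] instead of height splits the nodes at height exactly [s], and leaves the root
       [r] outside. *)
    have [|||||j|p pH pw] := @rank_functional_decrease R n G a s (x t) w
      [set j | c <= w j ord0]%SET r iM c a0 amin xw rr.
    - by rewrite inE -ltNge.
    - by rewrite inE; lra.
    - by move=> j; rewrite inE => cw; rewrite leNgt; apply/negP => /wl; lra.
    - by move=> j; rewrite inE -ltNge => cw; rewrite leNgt; apply/negP => /wr; lra.
    - by move=> j k; rewrite !inE -ltNge => cj ck; left; exact: lt_le_trans ck cj.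
    - by rewrite inE -ltNge => /ltW.
    exists p => //; apply: le_trans pw _; rewrite lerN2 ler_pM2l //; lra.
  have [|||||j|p pH pw] := @rank_functional_decrease R n G a (- s) (- x t) (- w)
    [set j | x t j ord0 < s]%SET r2 im (- w im ord0) a0 amin xwN rr2.
  - by rewrite inE -leNgt.
  - by rewrite inE.
  - by move=> j; rewrite inE mxE lerN2 => /ltW.
  - by move=> j; rewrite inE -leNgt mxE lerN2.
  - by move=> j k; rewrite !inE -leNgt !mxE !ltrN2 => xj xk; right; exact: lt_le_trans xj xk.
  - rewrite inE -leNgt mxE lerN2 => sj; apply: xw; exact: lt_le_trans ims sj.
  by exists p => //; apply: le_trans pw _; rewrite mxE subrr.
have -> : - (decrease_rate G a * ((f y2 - f y1) / 2)) =
    - (decrease_rate G a * 0) + - (decrease_rate G a * (c - f y1)).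
  by rewrite cE; field.
have {}hr r : is_root G r -> c <= w r ord0.
  by move=> rr; rewrite leNgt; apply/negP => rc; apply: hr; exists r.
apply: two_sided_decrease.
  have [|||||j|p pH pw] := @rank_functional_decrease R n G a s (x t) w
    [set j | s < x t j ord0]%SET r1 iM (w iM ord0) a0 amin xw rr1.
  - by rewrite inE -leNgt.
  - by rewrite inE.
  - by move=> j; rewrite inE => /ltW.
  - by move=> j; rewrite inE -leNgt.
  - by move=> j k; rewrite !inE -leNgt => sj xk; right; exact: le_lt_trans xk sj.
  - rewrite inE -leNgt => sj; apply: xw; exact: le_lt_trans sj siM.
  by exists p => //; apply: le_trans pw _; rewrite subrr.
have [|||||j|p pH pw] := @rank_functional_decrease R n G a (- s) (- x t) (- w)
  [set j | w j ord0 < c]%SET r1 im (- c) a0 amin xwN rr1.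
- by rewrite inE -leNgt hr.
- by rewrite inE; lra.
- by move=> j; rewrite inE mxE lerN2 => cw; rewrite leNgt; apply/negP => /wr; lra.
- by move=> j; rewrite inE mxE lerN2 -leNgt => cw; rewrite leNgt; apply/negP => /wl; lra.
- by move=> j k; rewrite !inE -leNgt !mxE !ltrN2 => cj ck; left; exact: lt_le_trans cj ck.
- by rewrite inE -leNgt mxE lerN2.
exists p => //; apply: le_trans pw _; rewrite mxE lerN2 ler_pM2l //; lra.
Qed.

End conclusion.

(** * The limiting box and convergence to the set *)

Section convergence.
Context (R : realType) (n : nat) (G : weightedDigraph R n).
Implicit Types (f : R -> R) (x : R -> 'cV[R]_n).

(** The value of [f] at the midpoint lies between its one-sided limits at every point of [m, M]. If
    m = M, all coordinates equal the midpoint and monotonicity suffices. *)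
Lemma box_sub_setD2 f (m M : R) (z : 'cV[R]_n) : {homo f : u v / u <= v} ->
  m <= M -> (forall y1 y2, m < y1 -> y1 <= y2 -> y2 < M -> f y2 <= f y1) ->
  (forall i, m <= z i ord0 <= M) -> setD2 f z.
Proof.
move=> fm mM fc zmM; exists (f ((m + M) / 2)) => i; rewrite mxE.
have /andP[mz zM] := zmM i.
apply/filippovP => //; move: mM; rewrite le_eqVlt => /orP[/eqP mM|mM].
  by split=> y ?; apply: fm; lra.
split=> y yz.
  apply: (@le_trans _ _ (f (Num.max y ((m + M) / 2)))).
    by apply: fm; rewrite le_max lexx.
  apply: fc; [lra | by rewrite le_max lexx orbT |].
  by rewrite gt_max; apply/andP; split; lra.
apply: (@le_trans _ _ (f (Num.min y ((m + M) / 2)))).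
  apply: fc; [| by rewrite ge_min lexx orbT | lra].
  by rewrite lt_min; apply/andP; split; lra.
by apply: fm; rewrite ge_min lexx.
Qed.

Lemma limit_interval f x : has_directed_spanning_tree G ->
  {homo f : u v / u <= v} -> inclusion_solution (consensus_rhs G f) x ->
  exists m M : R, [/\ m <= M,
    forall y1 y2, m < y1 -> y1 <= y2 -> y2 < M -> f y2 <= f y1 &
    forall e : R, 0 < e -> exists2 T : R, 0 <= T &
      forall t, T <= t -> forall i, m - e < x t i ord0 < M + e].
Proof.
move=> [r0 r0root] fm sol.
pose P : {set 'I_n} := [set r | [forall j, connect (edge G) r j]]%SET.
have PP r : r \in P -> is_root G r by rewrite inE => /forallP.
have r0P : r0 \in P by rewrite inE; apply/forallP.
have clP : in_closed G P.
  move=> i j /PP ir ji; rewrite inE; apply/forallP => k.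
  exact: connect_trans (connect1 ji) (ir k).
have clT : in_closed G finset.setT by move=> i j _ _; rewrite inE.
have [M [topM ltM]] := top_limit fm sol clT (finset.in_setT r0).
have [m [botm gtm]] := bottom_limit fm sol clT (finset.in_setT r0).
have [MP [topMP ltMP]] := top_limit fm sol clP r0P.
have [mP [botmP gtmP]] := bottom_limit fm sol clP r0P.
have box (e : R) : 0 < e -> exists2 T : R, 0 <= T &
    forall t, T <= t -> forall i, m - e < x t i ord0 < M + e.
  move=> e0; have [T T0 TM] := ltM e e0; have [T' T'0 T'm] := gtm e e0.
  exists (Num.max T T'); first by rewrite le_max T0.
  move=> t; rewrite ge_max => /andP[/TM tM /T'm tm] i.
  by rewrite tM ?tm ?inE.
have mM : m <= M.
  apply/ler_addgt0Pr => e e0.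
  have [T _ /(_ _ (lexx T) r0)] := box _ (divr_gt0 e0 (ltr0Sn R 1)); lra.
have mMP : mP <= MP.
  apply/ler_addgt0Pr => e e0; have e2 := divr_gt0 e0 (ltr0Sn R 1).
  have [T _ TM] := ltMP _ e2; have [T' _ T'm] := gtmP _ e2.
  have := TM (Num.max T T') _ r0 r0P; have := T'm (Num.max T T') _ r0 r0P.
  by rewrite !le_max !lexx orbT => /(_ isT) ? /(_ isT) ?; lra.
have lowr y : mP <= y -> forall t : R, 0 <= t -> exists2 r, is_root G r & x t r ord0 <= y.
  by move=> my t /botmP [r /PP rr rm]; exists r => //; exact: le_trans my.
have highr y : y <= MP -> forall t : R, 0 <= t -> exists2 r, is_root G r & y <= x t r ord0.
  by move=> yM t /topMP [r /PP rr rm]; exists r => //; exact: le_trans yM _.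
have {}topM t : 0 <= t -> exists i, M <= x t i ord0.
  by move=> /topM [i _ ?]; exists i.
have {}botm t : 0 <= t -> exists i, x t i ord0 <= m.
  by move=> /botm [i _ ?]; exists i.
have above := constant_above fm sol (lowr mP (lexx _)) topM.
have below := constant_below fm sol (highr MP (lexx _)) botm.
exists m, M; split => // y1 y2 my1 y12 y2M.
(* Constancy above [mP] or below [MP] settles the cases where [mP] is left of [y1] or right of [y2].
   Otherwise the interval is widened to [z1, z2], which has [mP] strictly inside. *)
have [|mPy1] := ltP mP y1; first by move=> ?; exact: above.
have [mP2|y2mP] := ltP mP ((y2 + M) / 2); last by apply: below => //; lra.
pose z1 := (m + y1) / 2; pose z2 := (y2 + M) / 2.
have ez1 : z1 = (m + y1) / 2 by []. have ez2 : z2 = (y2 + M) / 2 by [].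
apply: (@le_trans _ _ (f z2)); first by apply: fm; lra.
apply: (@le_trans _ _ (f z1)); last by apply: fm; lra.
apply: (constant_across (s := mP) fm sol (lowr _ (lexx _)) (highr _ mMP) topM botm); try lra.
- by move=> y z1y ymP; apply: below; lra.
- by move=> y mPy yz2; apply: above; lra.
Qed.

Lemma converges_to_set_box f x (m M : R) : m <= M ->
  (forall z : 'cV[R]_n, (forall i, m <= z i ord0 <= M) -> setD2 f z) ->
  (forall e : R, 0 < e -> exists2 T : R, 0 <= T &
      forall t, T <= t -> forall i, m - e < x t i ord0 < M + e) ->
  converges_to_set x (setD2 f).
Proof.
move=> mM boxD xbox.
have near_e (e : R) : 0 < e ->
    \forall t \near +oo, (edist_inf (setD2 f) (x t) <= e%:E)%E.
  move=> e0; have [T T0 Tx] := xbox e e0.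
  exists T; split; first exact: num_real.
  move=> t /ltW /Tx xt.
  (* The coordinatewise projection onto the box, within [e] of x(t) in the sup norm. *)
  pose z : 'cV[R]_n := \col_i Num.max m (Num.min M (x t i ord0)).
  have zD : setD2 f z.
    by apply: boxD => i; rewrite mxE le_max lexx /= ge_max mM ge_min lexx.
  apply: (@le_trans _ _ (edist (x t, z))).
    by apply: ereal_inf_lbound; exists z.
  apply: edist_fin => //=.
  rewrite mx_norm_ball /ball_ /= [ltLHS]/Num.Def.normr /= mx_normrE.
  apply: bigmax_lt => // -[i j] _ /=; rewrite !mxE (ord1 j).
  have /andP[x1 x2] := xt i; rewrite ltr_norml.
  by rewrite /Num.max /Num.min; case: ifP; case: ifP => //; lra.
(* The distance is extended-real valued, so it must first be shown eventually finite. *)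
rewrite /converges_to_set; apply/fine_cvgP; split.
  near=> t; rewrite ge0_fin_numE ?edist_inf_ge0 //.
  apply: (@le_lt_trans _ _ 1%:E); last exact: ltry.
  by near: t; exact: near_e.
apply/cvgrPdist_le => e e0; near=> t.
have le_e : (edist_inf (setD2 f) (x t) <= e%:E)%E by near: t; exact: near_e.
have ge0 := edist_inf_ge0 (setD2 f) (x t).
rewrite sub0r normrN ger0_norm ?fine_ge0 // -lee_fin fineK //.
by rewrite ge0_fin_numE // (le_lt_trans le_e) // ltry.
Unshelve. all: by end_near. Qed.

End convergence.

Theorem mainTheorem2 (R : realType) (n : nat) (G : weightedDigraph R n)
    (f : R -> R) (x : R -> 'cV[R]_n) :
  has_directed_spanning_tree G ->
  {homo f : y z / y <= z} ->
  `|f y| @[y --> +oo] --> +oo ->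
  inclusion_solution (consensus_rhs G f) x ->
  converges_to_set x (setD2 f).
Proof.
move=> Gtree fm _ sol.
have [m [M [mM fc xbox]]] := limit_interval Gtree fm sol.
apply: (converges_to_set_box mM _ xbox) => z; exact: box_sub_setD2.
Qed.
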